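(* Let $d\ge3$ and let $K:\mathbb{S}^{d-1}\times\mathbb{S}^{d-1}\to\mathbb{C}$ be a Hermitian, axially symmetric kernel of the form $$K(\xi,\zeta)=\sum_{\ell_1=-\infty}^{\infty}\ \sum_{\ell,\ell'\in\Lambda_{|\ell_1|}}c_{\ell_1}(\ell,\ell')\,Y_{\ell_1,\ell}(\xi)\,\overline{Y_{\ell_1,\ell'}(\zeta)},\qquad \xi,\zeta\in\mathbb{S}^{d-1},$$ with $$\sum_{\ell_1=-\infty}^{\infty}\ \sum_{\ell,\ell'\in\Lambda_{|\ell_1|}}|c_{\ell_1}(\ell,\ell')|\,\frac{\sqrt{N_{\ell_{d-1},d}N_{\ell'_{d-1},d}}}{\sigma_{d-1}}<\infty .$$ If $K$ is strictly positive definite on $\mathbb{S}^{d-1}$, then the mapping $c_{0}:\Lambda_{0}\times\Lambda_{0}\to\mathbb{C}$ is not identically zero.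
   Context: A Hermitian kernel $K:\Omega\times\Omega\to\mathbb{C}$ ($K(x,y)=\overline{K(y,x)}$) is called strictly positive definite on $\Omega$ if for every finite set $\Xi\subset\Omega$ of distinct points the matrix $(K(\xi,\zeta))_{\xi,\zeta\in\Xi}$ is positive definite on $\mathbb{C}^{|\Xi|}$. $\mathbb{S}^{d-1}$ is the unit sphere in $\mathbb{R}^d$ and $\sigma_{d-1}$ its surface area. $N_{0,d}=1$, $N_{j,d}=\frac{(2j+d-2)(j+d-3)!}{j!(d-2)!}$ for $j\ge1$. For $\ell_1\in\mathbb{Z}$, $\Lambda_{|\ell_1|}=\{\ell=(\ell_2,\ldots,\ell_{d-1})\in\mathbb{Z}^{d-2}:|\ell_1|\le\ell_2\le\cdots\le\ell_{d-1}\}$. In polar coordinates $\xi=(\theta_1,\ldots,\theta_{d-1})$, $\theta_1\in[0,2\pi)$, $\theta_j\in[0,\pi]$ for $j\ge2$ ($\xi_d=\cos\theta_{d-1}$, $\xi_{d-1}=\sin\theta_{d-1}\cos\theta_{d-2}$, ..., $\xi_2=\sin\theta_{d-1}\cdots\sin\theta_2\sin\theta_1$, $\xi_1=\sin\theta_{d-1}\cdots\sin\theta_2\cos\theta_1$), the functions $$Y_{\ell_1,\ell}(\xi)=Y_{\ell_1,\ldots,\ell_{d-1}}(\xi)=\frac{1}{\sqrt{2\pi}}e^{i\ell_1\theta_1}\prod_{j=2}^{d-1}{}_{j}\tilde P_{\ell_j}^{\ell_{j-1}}(\theta_j)$$ form an orthonormal basis of $L^2(\mathbb{S}^{d-1})$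 of spherical harmonics ($Y_{\ell_1,\ell}$ has degree $\ell_{d-1}$), where ${}_{j}\tilde P_{L}^{\ell}(\theta)={}_{j}c_L^{\ell}(\sin\theta)^{(2-j)/2}P_{L+(j-2)/2}^{-(\ell+(j-2)/2)}(\cos\theta)$ (extended continuously to $\theta\in\{0,\pi\}$), $P_\nu^\mu$ are the associated Legendre functions on $(-1,1)$ and ${}_{j}c_L^{\ell}=\left(\frac{2L+j-1}{2}\frac{(L+\ell+j-2)!}{(L-\ell)!}\right)^{1/2}$. Axially symmetric means invariant under simultaneous rotation $\theta_1\mapsto\theta_1+\alpha$ of both arguments for every $\alpha$ (every kernel of the displayed form has this property). *)

(* Defs.v *)
From HB Require Import structures.
From mathcomp Require Import all_boot all_order all_algebra.
From mathcomp Require Import finmap all_classical all_reals all_analysis.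
From mathcomp Require Import complex.
From mathcomp Require summability.

Set Implicit Arguments.
Unset Strict Implicit.
Unset Printing Implicit Defensive.

Import Order.TTheory GRing.Theory Num.Theory.
Import numFieldNormedType.Exports.

Local Open Scope classical_set_scope.
Local Open Scope ring_scope.
Local Open Scope sesquilinear_scope.

Definition hermitian_kernel {R : realType} {T : Type} (Omega : set T)
    (K : T -> T -> R[i]) : Prop :=
  forall x y, Omega x -> Omega y -> K x y = (K y x)^*.

Definition posdefmx {R : realType} {n : nat} (A : 'M[R[i]]_n) : Prop :=
  forall v : 'cV[R[i]]_n, v != 0 -> 0 < (v^t* *m A *m v) 0 0.

(* A finite set of n distinct points of Omega is given by an injective
   enumeration. *)
Definition strictly_positive_definite {R : realType} {T : Type}
    (Omega : set T) (K : T -> T -> R[i]) : Prop :=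
  hermitian_kernel Omega K /\
  forall (n : nat) (xi : 'I_n -> T),
    injective xi -> (forall i, Omega (xi i)) ->
    posdefmx (\matrix_(i, j) K (xi i) (xi j)).

Definition sphere (R : realType) (d : nat) : set 'rV[R]_d :=
  [set x | \sum_(i < d) x 0 i ^+ 2 = 1].
Arguments sphere : clear implicits.

(* theta j stands for theta_j, 1 <= j <= d - 1; the other values of theta are
   irrelevant. The column i : 'I_d holds the coordinate xi_(i+1). *)
Definition polar_point {R : realType} (d : nat) (theta : nat -> R) : 'rV[R]_d :=
  \row_(i < d)
    if i == 0%N :> nat then
      cos (theta 1%N) * \prod_(2 <= j < d) sin (theta j)
    else if i == 1%N :> nat then \prod_(1 <= j < d) sin (theta j)
    else cos (theta i) * \prod_(i.+1 <= j < d) sin (theta j).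

Definition polar_range {R : realType} (d : nat) : set (nat -> R) :=
  [set theta | 0 <= theta 1%N < 2 * pi /\
               forall j, (2 <= j < d)%N -> 0 <= theta j <= pi].
Arguments polar_range {R} d _.

(* Polar coordinates are not unique where some sin theta_j (j >= 2) vanishes;
   the value of the functions Y below does not depend on the choice. *)
Definition polar_coord {R : realType} (d : nat) (x : 'rV[R]_d) : nat -> R :=
  xget (fun=> 0) [set theta | polar_range d theta /\ polar_point d theta = x].

(* polar_point accepts arbitrary real angles, so theta_1 + alpha needs no
   reduction modulo 2 pi. *)
Definition axially_symmetric {R : realType} (d : nat)
    (K : 'rV[R]_d -> 'rV[R]_d -> R[i]) : Prop :=
  let rot (alpha : R) (theta : nat -> R) j :=
    if j == 1%N then theta j + alpha else theta j in
  forall (alpha : R) (theta phi : nat -> R),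
    K (polar_point d (rot alpha theta)) (polar_point d (rot alpha phi)) =
    K (polar_point d theta) (polar_point d phi).

(* Gauss' product for 1 / Gamma, which is an entire function:
   1 / Gamma(x) = lim_n x (x + 1) ... (x + n) / (n! n^x). *)
Definition inv_Gamma {R : realType} (x : R) : R :=
  limn (fun n : nat =>
    (\prod_(0 <= k < n.+1) (x + k%:R)) / (n`!%:R * (n%:R `^ x))).

Definition rising {R : realType} (a : R) (k : nat) : R :=
  \prod_(0 <= i < k) (a + i%:R).

(* Olver's regularized function 2F1(a, b; c; z) / Gamma(c), |z| < 1. *)
Definition hypergeometric_reg {R : realType} (a b c z : R) : R :=
  limn (series (fun k : nat =>
    rising a k * rising b k * inv_Gamma (c + k%:R) / k`!%:R * z ^+ k)).

(* Associated Legendre function (of the first kind, on the cut) P_nu^mu(x),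
   -1 < x < 1. The regularization is needed for mu = 1, 2, ... *)
Definition legendreP {R : realType} (nu mu x : R) : R :=
  ((1 + x) / (1 - x)) `^ (mu / 2) *
  hypergeometric_reg (nu + 1) (- nu) (1 - mu) ((1 - x) / 2).

(* The factorials are only used where their arguments are nonnegative. *)
Definition Pcoef (R : realType) (j : nat) (L l : int) : R :=
  Num.sqrt ((2 * L%:~R + j%:R - 1) / 2 *
    ((absz (L + l + j%:Z - 2)%R)`!%:R / (absz (L - l)%R)`!%:R)).

Definition Ptilde_open {R : realType} (j : nat) (L l : int) (t : R) : R :=
  Pcoef R j L l * (sin t) `^ ((2 - j%:R) / 2) *
  legendreP (L%:~R + (j%:R - 2) / 2) (- (l%:~R + (j%:R - 2) / 2)) (cos t).

Definition Ptilde {R : realType} (j : nat) (L l : int) (t : R) : R :=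
  if t == 0 then lim (Ptilde_open j L l s @[s --> (0 : R)^'+])
  else if t == pi then lim (Ptilde_open j L l s @[s --> (pi : R)^'-])
  else Ptilde_open j L l t.

(* The tuple l = (l_2, ..., l_(d-1)) is indexed from 0. *)
Definition Lambda (d : nat) (m : int) : set (d.-2.-tuple int) :=
  [set l : d.-2.-tuple int | path <=%R m l].
Arguments Lambda : clear implicits.

Definition Ysph {R : realType} (d : nat) (l1 : int) (l : d.-2.-tuple int)
    (x : 'rV[R]_d) : R[i] :=
  let theta := polar_coord x in
  let ell j := nth 0 (l1 :: l) j.-1 in
  (((Num.sqrt (2 * pi))^-1)%:C *
   (cos (l1%:~R * theta 1%N) +i* sin (l1%:~R * theta 1%N)) *
   (\prod_(2 <= j < d) Ptilde j (ell j) (ell j.-1) (theta j))%:C)%C.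

(* Dimension of the space of spherical harmonics of degree j. *)
Definition harmdim (R : realType) (j d : nat) : R :=
  if j == 0%N then 1
  else ((2 * j + d - 2) * (j + d - 3)`!)%:R / (j`! * (d - 2)`!)%:R.

(* 2 pi^(d/2) / Gamma(d/2), the area of the unit sphere of R^d. *)
Definition sphere_area (R : realType) (d : nat) : R :=
  2 * pi `^ (d%:R / 2) * inv_Gamma (d%:R / 2).

Definition kindex (d : nat) : choiceType :=
  (int * d.-2.-tuple int * d.-2.-tuple int)%type.

Definition kindices (d : nat) : set (kindex d) :=
  [set i : kindex d | Lambda d `|i.1.1| i.1.2 /\ Lambda d `|i.1.1| i.2].
Arguments kindices : clear implicits.

Definition coef_summable {R : realType} (d : nat)
    (c : int -> d.-2.-tuple int -> d.-2.-tuple int -> R[i]) : Prop :=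
  let N (l : d.-2.-tuple int) := harmdim R (absz (last 0 l)) d in
  (\esum_(i in kindices d)
     (Normc.normc (c i.1.1 i.1.2 i.2) *
      (Num.sqrt (N i.1.2 * N i.2) / sphere_area R d))%:E < +oo)%E.

(* s is the unconditional sum of f over A: the limit of the sums over the
   finite subsets of A, directed by inclusion. *)
Definition has_sum {R : realType} {I : choiceType} (A : set I) (f : I -> R[i])
    (s : R[i]) : Prop :=
  summability.partial_sum (fun i => if i \in A then f i else 0)
    @ summability.totally --> (s : R[i]^o).

Definition kernel_expansion {R : realType} (d : nat)
    (c : int -> d.-2.-tuple int -> d.-2.-tuple int -> R[i])
    (K : 'rV[R]_d -> 'rV[R]_d -> R[i]) : Prop :=
  forall x y, sphere R d x -> sphere R d y ->
    has_sum (kindices d)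
      (fun i => c i.1.1 i.1.2 i.2 * Ysph i.1.1 i.1.2 x * (Ysph i.1.1 i.2 y)^*)
      (K x y).

(* Main.v *)
(* Take the pole x with theta_(d-1) = 0. If l1 <> 0, the factor of Y_(l1,l)
   depending on theta_(d-1) is O((1 - cos theta)^(1/2)) as theta -> 0, so
   Y_(l1,l) vanishes at x. Hence K(x, x) only involves c_0, and positivity of
   the 1 x 1 matrix K(x, x) prevents c_0 from being zero. *)
Require Import Defs.
From mathcomp Require Import all_boot all_order all_algebra.
From mathcomp Require Import all_classical all_reals all_analysis.
From mathcomp Require Import complex.
From mathcomp Require Import ring lra zify.
From mathcomp Require summability.
Import Order.TTheory GRing.Theory Num.Theory.
Import numFieldNormedType.Exports.
Local Open Scope classical_set_scope.
Local Open Scope ring_scope.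

(** * The reciprocal Gamma function *)

(* Convergence of Gauss' product is never needed: the products at x and x + 1
   converge simultaneously, and a divergent limn is 0. *)
Lemma inv_Gamma_rec (R : realType) (x : R) : inv_Gamma x = x * inv_Gamma (x + 1).
Proof.
rewrite /inv_Gamma; set f := fun n : nat => _; set g := fun n : nat => _.
have [x0|x0] := eqVneq x 0.
  rewrite x0 mul0r (_ : f = fun=> 0) ?lim_cst//; apply/funext => n.
  by rewrite /f big_nat_recl// x0 addr0 !mul0r.
(* [r n] is [(x + n + 2) / (n + 1)], the ratio of [x * g n.+1] to [f n.+1]. The shift to [n.+1]
   keeps the base of the power nonzero. *)
pose r n : R := 1 + (x + 1) * harmonic n.
have fg n : f n.+1 * r n = x * g n.+1.
  rewrite /f /g /r /harmonic/= big_nat_recl// [in RHS]big_nat_recr//= addr0.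
  under [in RHS]eq_bigr do rewrite addrAC -addrA natr1.
  rewrite powRD; last by rewrite pnatr_eq0 implybT.
  rewrite powRr1//.
  have p0 : n.+1%:R `^ x != 0 :> R by rewrite gt_eqF// powR_gt0.
  have n0 : n.+1%:R != 0 :> R by rewrite pnatr_eq0.
  have q0 : (n.+1)`!%:R != 0 :> R by rewrite pnatr_eq0 -lt0n fact_gt0.
  rewrite -[n.+1%:R]natr1 in n0 *.
  field.
  by rewrite natr1 in n0 *; rewrite n0 q0 p0.
have r1 : r @ \oo --> (1 : R).
  rewrite (_ : 1 = 1 + (x + 1) * 0); last by rewrite mulr0 addr0.
  by apply: cvgD; [exact: cvg_cst|apply: cvgMl_tmp; exact: cvg_harmonic].
have rV1 : (fun n => (r n)^-1) @ \oo --> (1 : R).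
  by rewrite -[X in _ --> X]invr1; apply: cvgV => //; rewrite oner_eq0.
have [cf|ncf] := pselect (cvgn f).
  suff : g @ \oo --> x^-1 * limn f by move/cvg_lim => ->//; rewrite mulVKf.
  rewrite -cvg_shiftS/=.
  under eq_fun do rewrite -[g _](mulKf x0) -fg.
  apply: cvgMl_tmp; rewrite -[X in _ --> X]mulr1; apply: cvgM => //.
  by rewrite (cvg_shiftS f).
have [cg|ncg] := pselect (cvgn g); last by rewrite (dvgP ncf) (dvgP ncg) mulr0.
case: ncf; apply/cvg_ex; exists (x * limn g * 1).
rewrite -cvg_shiftS/=.
(* [r n] may vanish when [x] is a negative integer, but only for one [n]. *)
have nr : \forall n \near \oo, x * g n.+1 * (r n)^-1 = f n.+1.
  have : \forall n \near \oo, 0 < r n by exact: (cvgr_gt 1).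
  by apply: filterS => n rn; rewrite -fg mulfK// gt_eqF.
apply: cvg_trans (near_eq_cvg nr) _.
apply: cvgM => //; apply: cvgMl_tmp.
by rewrite (cvg_shiftS g).
Qed.

(** The factor [x] of the recurrence gives the zero at 0, and the recurrence carries it down to the
    other poles of Gamma. *)
Lemma inv_Gamma_Nnat (R : realType) (n : nat) : inv_Gamma (- n%:R : R) = 0.
Proof.
elim: n => [|n IHn]; first by rewrite oppr0 inv_Gamma_rec mul0r.
by rewrite inv_Gamma_rec -natr1 opprD addrNK IHn mulr0.
Qed.

(** * Bounds for power series near 0 *)

(** The sum of the first [n0.+1] norms serves as [C]: as [1 <= rho], it covers the terms before the
    ratio estimate starts, and induction covers the rest. *)
Lemma ratio_bound (R : realType) (u : nat -> R) (rho : R) (n0 : nat) :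
  1 <= rho -> (forall k, (n0 <= k)%N -> `|u k.+1| <= rho * `|u k|) ->
  exists2 C, 0 <= C & forall k, `|u k| <= C * rho ^+ k.
Proof.
move=> rho1 step; exists (\sum_(i < n0.+1) `|u i|); first exact: sumr_ge0.
have small k : (k <= n0)%N -> `|u k| <= \sum_(i < n0.+1) `|u i|.
  rewrite -ltnS => kn; rewrite (bigD1 (Ordinal kn))//= lerDl.
  exact: sumr_ge0.
elim=> [|k IHk]; first by rewrite mulr1 small.
have [kn|nk] := ltnP k n0.
  by rewrite (le_trans (small _ kn))// ler_peMr ?sumr_ge0// exprn_ege1.
rewrite (le_trans (step _ nk))// exprS mulrCA ler_wpM2l//.
exact: le_trans rho1.
Qed.

(** Comparison with the geometric tail from [m] on, whose sum is at most twice its first term since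
    the ratio is at most 1/2. *)
Lemma power_series_small (R : realType) (u : nat -> R) (C rho z : R) (m : nat) :
  0 <= C -> 0 <= rho -> (forall k, `|u k| <= C * rho ^+ k) ->
  (forall k, (k < m)%N -> u k = 0) -> 0 <= z -> rho * z <= 2^-1 ->
  `|limn (series (fun k => u k * z ^+ k))| <= 2 * C * (rho * z) ^+ m.
Proof.
move=> C0 rho0 uC um z0; set q := rho * z => q2.
have q0 : 0 <= q by exact: mulr_ge0.
(* The subtracted power makes the induction close: adding [C * q ^+ n] needs only
   [q ^+ n <= 2 * (q ^+ n - q ^+ n.+1)], that is, [q <= 1/2]. *)
have partial n : `|series (fun k => u k * z ^+ k) n| <=
    2 * C * (q ^+ m - q ^+ maxn m n).
  rewrite /series/=; elim: n => [|n IHn].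
    by rewrite big_geq// normr0 maxn0 subrr mulr0.
  rewrite big_nat_recr//= (le_trans (ler_normD _ _))//.
  have [nm|mn] := ltnP n m.
    rewrite um// mul0r normr0 addr0 (le_trans IHn)//.
    by rewrite (maxn_idPl (ltnW nm)) (maxn_idPl nm).
  move: IHn; rewrite (maxn_idPr mn) (maxn_idPr (leqW mn)) => IHn.
  have un : `|u n * z ^+ n| <= C * q ^+ n.
    rewrite normrM (ger0_norm (exprn_ge0 _ z0)) exprMn mulrA.
    by rewrite ler_wpM2r// exprn_ge0.
  rewrite (le_trans (lerD IHn un))// exprS.
  have : 0 <= C * q ^+ n by rewrite mulr_ge0// exprn_ge0.
  set w := q ^+ n; nra.
have bnd n : `|series (fun k => u k * z ^+ k) n| <= 2 * C * q ^+ m.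
  rewrite (le_trans (partial n))// ler_wpM2l ?mulr_ge0// gerBl.
  exact: exprn_ge0.
(* A divergent series has [limn] equal to 0, which satisfies the bound trivially. *)
have [cs|ncs] := pselect (cvgn (series (fun k => u k * z ^+ k))).
  rewrite -lim_norm//; apply: limr_le; first exact: is_cvg_norm.
  by near=> n; exact: bnd.
by rewrite (dvgP ncs) normr0 mulr_ge0 ?mulr_ge0 ?exprn_ge0.
Unshelve. all: by end_near. Qed.

Lemma hypergeometric_reg_small (R : realType) (a b c : R) (m : nat) :
  (forall k, (k < m)%N -> inv_Gamma (c + k%:R) = 0) ->
  exists2 C, 0 <= C & forall z, 0 <= z <= 16^-1 ->
    `|hypergeometric_reg a b c z| <= C * z ^+ m.
Proof.
move=> cm.
pose u k := rising a k * rising b k * inv_Gamma (c + k%:R) / k`!%:R.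
have risingS x k : rising x k.+1 = rising x k * (x + k%:R) :> R.
  by rewrite /rising big_nat_recr.
(* The denominators are cleared so that the recurrence stays valid when [c + k = 0]. *)
have uS k : u k.+1 * ((k.+1)%:R * (c + k%:R)) = u k * ((a + k%:R) * (b + k%:R)).
  rewrite /u !risingS (inv_Gamma_rec _ (c + k%:R)) -addrA natr1 factS natrM.
  have k0 : k.+1%:R != 0 :> R by rewrite pnatr_eq0.
  have f0 : k`!%:R != 0 :> R by rewrite pnatr_eq0 -lt0n fact_gt0.
  set g := inv_Gamma _; set ra := rising a k; set rb := rising b k.
  field.
  by rewrite f0 nat1r.
(* Beyond [n0], both numerator factors are at most [2k] and [(k + 1)|c + k|] is at least [k^2/2],
   whence the ratio 8. The radius 1/16 then makes [8 * z] at most 1/2. *)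
pose n0 := Num.bound (`|a| + `|b| + 2 * `|c| + 1).
have step k : (n0 <= k)%N -> `|u k.+1| <= 8 * `|u k|.
  move: u uS => u uS nk.
  have : `|a| + `|b| + 2 * `|c| + 1 < k%:R.
    apply: (@lt_le_trans _ _ n0%:R); last by rewrite ler_nat.
    by apply: archi_boundP; rewrite !addr_ge0// mulr_ge0.
  move: (normr_ge0 a) (normr_ge0 b) (normr_ge0 c) => a0 b0 c0 big.
  have ak : `|a + k%:R| <= 2 * k%:R.
    by rewrite (le_trans (ler_normD _ _))// (ger0_norm (ler0n _ _)); lra.
  have bk : `|b + k%:R| <= 2 * k%:R.
    by rewrite (le_trans (ler_normD _ _))// (ger0_norm (ler0n _ _)); lra.
  have ck : 2^-1 * k%:R <= `|c + k%:R|.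
    have := lerB_normD k%:R c; rewrite (ger0_norm (ler0n _ _)) [c + _]addrC; lra.
  have k0 : 0 < k%:R :> R by lra.
  have := congr1 Num.norm (uS k); rewrite !normrM (ger0_norm (ler0n _ _)) => e.
  have h1 : `|a + k%:R| * `|b + k%:R| <= 2 * k%:R * (2 * k%:R) by exact: ler_pM.
  have h2 : k%:R * (2^-1 * k%:R) <= k.+1%:R * `|c + k%:R|.
    by apply: ler_pM => //; rewrite ?ler_nat// mulr_ge0// ltW.
  have h3 := ler_wpM2l (normr_ge0 (u k)) h1.
  have h4 := ler_wpM2l (normr_ge0 (u k.+1)) h2.
  have kk : 0 < k%:R * k%:R :> R by exact: mulr_gt0.
  rewrite -(ler_pM2r kk); lra.
have [C C0 uC] := ratio_bound _ u 8 n0 (ler1n _ 8) step.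
exists (2 * C * 8 ^+ m) => [|z /andP[z0 z16]]; first by rewrite !mulr_ge0.
rewrite -mulrA -exprMn; apply: power_series_small => //.
- by move=> k km; rewrite /u cm// mulr0 mul0r.
- lra.
Qed.

(** * The Legendre factor at the pole *)

(* The case l < 0, j = 2 occurs for d = 3, where l is l_1 itself: the first
   |l| coefficients of the hypergeometric series then vanish, which compensates
   for the factor (1 - cos t)^(l/2). *)
Lemma Ptilde0 (R : realType) (j : nat) (L l : int) :
  (0 < l) || (j == 2%N) && (l != 0) -> Ptilde j L l (0 : R) = 0.
Proof.
move=> lj; rewrite /Ptilde eqxx.
set h : R := (j%:R - 2) / 2.
(* [m] counts leading coefficients that vanish. The total power of [1 - cos t] will be [l/2 + m],
   and the first condition makes it at least 1/2. *)
have [m lm cm] : exists2 m : nat, 1 <= l%:~R + 2 * m%:R :> R &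
    forall k, (k < m)%N -> inv_Gamma (1 + (l%:~R + h) + k%:R) = 0 :> R.
  case: (ltrP 0 l) lj => [l0 _|l0 /= /andP[/eqP j2 ln0]].
    by exists 0%N => //; rewrite mulr0 addr0 ler1z; lia.
  have lE : l%:~R = - `|l|%N%:R :> R by rewrite pmulrn -mulrNz; congr _%:~R; lia.
  exists `|l|%N => [|k kl].
    have : 1 <= `|l|%N%:R :> R by rewrite ler1n absz_gt0.
    rewrite lE; lra.
  rewrite (_ : _ + _ = - (`|l| - k.+1)%N%:R) ?inv_Gamma_Nnat//.
  by rewrite natrB// -natr1 lE /h j2; ring.
have [C C0 FC] :=
  hypergeometric_reg_small _ (L%:~R + h + 1) (- (L%:~R + h)) _ m cm.
apply: cvg_lim => //; apply/norm_cvg0P.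
set mu := - (l%:~R + h); set e : R := - h.
pose B := e / 2 + mu / 2.
apply: (@squeeze_cvgr _ _ _ _ (fun=> 0)
  (fun s => `|Pcoef R j L l| * 2 `^ `|B| * C * Num.sqrt (1 - cos s))).
(* The threshold 7/8 gives [(1 - cos s) / 2 <= 1/16], the range of the hypergeometric bound. *)
- have cos7 : \forall s \near (0 : R)^'+, 7 / 8 < cos s.
    apply: (cvgr_gt 1); last lra.
    rewrite -(@cos0 R); apply: cvg_at_right_filter; exact: continuous_cos.
  near=> s.
  rewrite normr_ge0/=.
  have s0 : 0 < s by near: s; exact: nbhs_right_gt.
  have spi : s < pi by near: s; apply: nbhs_right_lt; exact: pi_gt0.
  have sin0 : 0 < sin s by rewrite sin_gt0_pi// s0.
  have c7 : 7 / 8 < cos s by near: s; exact: cos7.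
  have sin2 : (sin s) ^+ 2 = (1 - cos s) * (1 + cos s) by rewrite sin2cos2; ring.
  have v1 : 1 <= 1 + cos s by lra.
  have v2 : 1 + cos s <= 2 by have := cos_le1 s; lra.
  have u0 : 0 < 1 - cos s.
    by have := exprn_gt0 2 sin0; rewrite sin2 pmulr_lgt0//; lra.
  have u8 : 1 - cos s <= 1 / 8 by lra.
  have sE : sin s = ((1 - cos s) * (1 + cos s)) `^ 2^-1.
    by rewrite -sin2 powR12_sqrt ?sqr_ge0// sqrtr_sqr gtr0_norm.
  rewrite /Ptilde_open /legendreP -/h -/mu.
  have -> : (2 - j%:R) / 2 = e :> R by rewrite /e /h; lra.
  rewrite (_ : 1 - mu = 1 + (l%:~R + h)); last by rewrite /mu opprK.
  (* u = 1 - cos s and v = 1 + cos s, so that sin s = (u v)^(1/2) *)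
  have := FC ((1 - cos s) / 2); move: (hypergeometric_reg _ _ _ _) => F.
  move: (1 - cos s) (1 + cos s) sE u0 u8 v1 v2 => u v sE u0 u8 v1 v2 {}FC.
  have z16 : 0 <= u / 2 <= 16^-1 by lra.
  have v0 : 0 < v by lra.
  have -> : sin s `^ e = u `^ (e / 2) * v `^ (e / 2).
    by rewrite sE -powRrM [_^-1 * _]mulrC powRM ?ltW.
  have -> : (v / u) `^ (mu / 2) = v `^ (mu / 2) * u `^ (- (mu / 2)).
    by rewrite powRM ?invr_ge0 ?ltW// -(powR_inv1 (ltW u0)) -powRrM mulN1r.
  (* The exponent [B] may have either sign, but [v] lies between 1 and 2. *)
  have vB : v `^ (e / 2) * v `^ (mu / 2) <= 2 `^ `|B|.
    rewrite -powRD; last by rewrite (gt_eqF v0) implybT.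
    rewrite (le_trans (ler_powR v1 (ler_norm B)))//.
    by apply: ge0_ler_powR => //; rewrite nnegrE; lra.
  (* The exponents on the left add up to [l/2 + m >= 1/2], and [u <= 1]. *)
  have uB : u `^ (e / 2) * u `^ (- (mu / 2)) * u ^+ m <= Num.sqrt u.
    rewrite -(powR_mulrn _ (ltW u0)) -!powRD; [|by rewrite (gt_eqF u0) implybT..].
    rewrite -(powR12_sqrt (ltW u0)).
    have u01 : 0 < u <= 1 by lra.
    apply: (ger_powR u01).
    rewrite /e /mu; lra.
  have Fu : `|F| <= C * u ^+ m.
    rewrite (le_trans (FC z16))// ler_wpM2l//.
    by apply: lerXn2r; rewrite ?nnegrE; lra.
  rewrite !normrM !(ger0_norm (powR_ge0 _ _)).
  have uu0 : 0 <= u `^ (e / 2) * u `^ (- (mu / 2)) by rewrite mulr_ge0 ?powR_ge0.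
  have h1 := ler_wpM2l uu0 Fu.
  have h2 := ler_wpM2l C0 uB.
  have h3 : u `^ (e / 2) * u `^ (- (mu / 2)) * `|F| <= C * Num.sqrt u.
    by rewrite (le_trans h1)// mulrCA.
  have h4 := ler_pM (mulr_ge0 (powR_ge0 v (e / 2)) (powR_ge0 v (mu / 2)))
    (mulr_ge0 uu0 (normr_ge0 F)) vB h3.
  have := ler_wpM2l (normr_ge0 (Pcoef R j L l)) h4.
  by congr (_ <= _); ring.
- exact: cvg_cst.
- have : Num.sqrt (1 - cos s) @[s --> (0 : R)^'+] --> Num.sqrt (1 - cos (0 : R)).
    apply: cvg_at_right_filter.
    apply: (@continuous_comp _ _ _ (fun s : R => 1 - cos s) Num.sqrt).
      by apply: cvgB; [exact: cvg_cst|exact: continuous_cos].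
    exact: sqrt_continuous.
  rewrite cos0 subrr sqrtr0 => sqrt_to0.
  rewrite -[X in _ --> X](mulr0 (`|Pcoef R j L l| * 2 `^ `|B| * C)).
  exact: cvgMl_tmp.
Unshelve. all: by end_near. Qed.

(** * Spherical harmonics at the pole *)

Lemma polar_point0 (R : realType) (d : nat) (i : 'I_d) :
  (3 <= d)%N -> polar_point d (fun=> 0 : R) 0 i = (i == d.-1 :> nat)%:R.
Proof.
move=> d3; rewrite mxE sin0 cos0.
have z a : (a < d)%N -> \prod_(a <= j < d) (0 : R) = 0.
  by move=> ad; rewrite big_ltn// mul0r.
have := ltn_ord i.
case: ifP => [/eqP -> _|_]; first by rewrite z// mulr0 ltn_eqF//; lia.
case: ifP => [/eqP -> _|_ id]; first by rewrite z ?ltn_eqF//; lia.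
have [->|ne] := eqVneq (i : nat) d.-1; first by rewrite big_geq ?mulr1//; lia.
by rewrite z ?mulr0//; lia.
Qed.

(** The other angles chosen by [polar_coord] are not determined at the pole. The last coordinate
    forces the cosine of the last angle to be 1, and cosine is injective on [[0, pi]]. *)
Lemma polar_coord_pole (R : realType) (d : nat) :
  (3 <= d)%N -> polar_coord (polar_point d (fun=> 0 : R)) d.-1 = 0.
Proof.
move=> d3; rewrite /polar_coord.
set P := [set theta | _].
have : P (xget (fun=> 0) P).
  apply: xgetPex; exists (fun=> 0); split => //; split.
    by rewrite lexx mulr_gt0// pi_gt0.
  by move=> j _; rewrite lexx pi_ge0.
move: (xget _ _) => theta [[_ rng]].
have d1 : (d.-1 < d)%N by lia.
move/matrixP/(_ 0 (Ordinal d1)); rewrite polar_point0// eqxx mxE/=.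
rewrite !ifF ?[(_ == _)]gtn_eqF//; try lia.
rewrite big_geq ?mulr1; last by lia.
rewrite -cos0; apply: cos_inj; rewrite in_itv/=.
  by apply: rng; lia.
by rewrite lexx pi_ge0.
Qed.

Lemma polar_point0_sphere (R : realType) (d : nat) :
  (3 <= d)%N -> sphere R d (polar_point d (fun=> 0)).
Proof.
move=> d3; rewrite /sphere/=.
have d1 : (d.-1 < d)%N by lia.
rewrite (bigD1 (Ordinal d1))//= big1 => [|i ne].
  by rewrite polar_point0// eqxx expr1n addr0.
by rewrite polar_point0// (_ : (_ == _) = false) ?expr0n//; apply/negbTE.
Qed.

Lemma Ysph_pole (R : realType) (d : nat) (l1 : int) (l : d.-2.-tuple int) :
  (3 <= d)%N -> l1 != 0 -> Lambda d `|l1| l ->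
  Ysph l1 l (polar_point d (fun=> 0 : R)) = 0.
Proof.
move=> d3 l10 lam; rewrite /Ysph.
have big_last (F : nat -> R) :
    \prod_(2 <= j < d) F j = \prod_(2 <= j < d.-1) F j * F d.-1.
  by rewrite -{1}(@prednK d) ?big_nat_recr//; lia.
rewrite big_last polar_coord_pole// Ptilde0 ?mulr0//.
move: lam (size_tuple l); rewrite /Lambda/=; case: l => /= l _ lam size_l.
(* For [d = 3] the order in the last factor is [l1] itself, of either sign. For larger [d] it is an
   entry of [l], hence at least [|l1| > 0]. *)
have [d3'|d4] := leqP d 3.
  by rewrite (_ : d = 3%N) ?l10 ?orbT//; lia.
rewrite (_ : d.-1.-2 = d.-2.-2.+1)//=; last by lia.
have /(order_path_min le_trans)/allP/(_ _ (mem_nth 0 _)) lb := lam.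
by rewrite (lt_le_trans _ (lb _ _)) ?normr_gt0// size_l; lia.
Qed.

Theorem lemma10 (R : realType) (d : nat) (d_ge3 : (3 <= d)%N)
  (K : 'rV[R]_d -> 'rV[R]_d -> R[i])
  (c : int -> d.-2.-tuple int -> d.-2.-tuple int -> R[i])
  (K_herm : hermitian_kernel (sphere R d) K)
  (K_axial : axially_symmetric K)
  (K_exp : kernel_expansion c K)
  (c_sum : coef_summable c)
  (K_spd : strictly_positive_definite (sphere R d) K) :
  exists l l' : d.-2.-tuple int,
    [/\ Lambda d 0 l, Lambda d 0 l' & c 0 l l' <> 0].
Proof.
apply: contrapT => nex.
have c0 l l' : Lambda d 0 l -> Lambda d 0 l' -> c 0 l l' = 0.
  by move=> hl hl'; apply: contrapT => h; apply: nex; exists l, l'.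
set x := polar_point d (fun=> 0 : R).
have Sx : sphere R d x by exact: polar_point0_sphere.
(* Every term vanishes at [(x, x)], so the net of finite sums is constantly 0 and uniqueness of
   limits applies. *)
have Kx : K x x = 0.
  have := K_exp x x Sx Sx; rewrite /has_sum (_ : summability.partial_sum _ = fun=> 0).
    move=> h; have totallyF := @summability.totally_filter (kindex d).
    have PF := @fmap_proper_filter _ _ (fun=> 0 : R[i]^o) _ totallyF.
    have z := @cvg_cst (R[i]^o) 0 _ _ (@filter_filter _ _ totallyF).
    exact: (@norm_cvg_unique R[i] (R[i]^o) _ PF _ _ h z).
  apply/funext => A; rewrite /summability.partial_sum big1// => -[[[l1 l] l'] iA] _ /=.
  case: ifPn => // /set_mem [/= hl hl'].
  have [l10|l1n] := eqVneq l1 0; last by rewrite Ysph_pole// mulr0 mul0r.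
  by move: hl hl'; rewrite l10 normr0 => hl hl'; rewrite c0// !mul0r.
have := K_spd.2 1%N (fun=> x).
have inj : injective (fun _ : 'I_1 => x) by move=> i k _; rewrite !ord1.
move=> /(_ inj (fun=> Sx) (const_mx 1)).
rewrite (_ : \matrix_(i, j) _ = 0); last by apply/matrixP => i j; rewrite !mxE.
rewrite mulmx0 mul0mx mxE ltxx => abs; suff : false by [].
apply: abs; apply/eqP => /matrixP /(_ 0 0); rewrite !mxE => /eqP.
by rewrite oner_eq0.
Qed.
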